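(* Let $K\subseteq\mathbf{R}^n$ be a nonempty closed set, let $f=(f_1,\dots,f_s):\mathbf{R}^n\to\mathbf{R}^s$ be a vector polynomial with $\deg f_i=d_i\ge 1$ for $i=1,\dots,s$, and let $\mathbf{d}=(d_1,\dots,d_s)$. Then: (i) If $SOL^{w}(K_\infty,f^\infty)=\emptyset$, then there exists $\epsilon>0$ such that $SOL^{w}(K,f+g)=\emptyset$ for all $g\in\mathbf{P}_{\mathbf{d}}$ satisfying $\|g\|<\epsilon$. (ii) If $SOL^{w}(K_\infty,f^\infty)=\{0\}$, then there exists $\epsilon>0$ such that $SOL^{s}(K,f+g)$ is nonempty and $SOL^{w}(K,f+g)$ is compact for all $g\in\mathbf{P}_{\mathbf{d}}$ satisfying $\|g\|<\epsilon$.
   Context: $\mathbf{R}^s_+$ is the nonnegative orthant. For a nonempty closed set $C\subseteq\mathbf{R}^n$ and a vector polynomial $h:\mathbf{R}^n\to\mathbf{R}^s$, $SOL^{s}(C,h)$ (Pareto efficient solutions) is the set of $x^*\in C$ such that $h(x)-h(x^* )\notin-\mathbf{R}^s_+\setminus\{0\}$ for all $x\in C$, and $SOL^{w}(C,h)$ (weak Pareto efficient solutions) is the set of $x^*\in C$ such that $h(x)-h(x^* )\notin-\mathrm{int}\,\mathbf{R}^s_+$ for all $x\in C$. The asymptotic cone of $K$ is $K_\infty=\{v\in\mathbf{R}^n:\text{ there exist } t_k\to+\infty \text{ and } x_k\in K \text{ with } x_k/t_k\to v\}$. For a vector polynomial $p=(p_1,\dots,p_s)$ with component degrees $\deg p_i$,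 $p^\infty=(p_1^\infty,\dots,p_s^\infty)$ where $p_i^\infty(x)=\lim_{\lambda\to+\infty}p_i(\lambda x)/\lambda^{\deg p_i}$. $\mathbf{P}_d$ is the finite-dimensional space of real polynomials in $n$ variables of degree at most $d$, normed by the Euclidean norm of the coefficient vector; $\mathbf{P}_{\mathbf{d}}=\mathbf{P}_{d_1}\times\dots\times\mathbf{P}_{d_s}$ carries the corresponding product norm (e.g. the Euclidean norm of all coefficients). *)

(* Defs.v *)
From HB Require Import structures.
From mathcomp Require Import all_boot all_order all_algebra.
From mathcomp Require Import all_classical all_reals all_analysis.
(* The notations of mpoly clash with those of mathcomp-analysis. *)
From mathcomp Require Import -(notations) mpoly.

Set Implicit Arguments.
Unset Strict Implicit.
Unset Printing Implicit Defensive.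

Import Order.TTheory GRing.Theory Num.Theory.
Import numFieldNormedType.Exports.

Local Open Scope classical_set_scope.
Local Open Scope ring_scope.

(* R^n is 'rV[R]_n, with the topology of mathcomp-analysis (entrywise
   convergence, i.e. the usual topology).  A vector polynomial R^n -> R^s is a
   family 'I_s -> mpoly n R of polynomials in n variables. *)

Section Polynomials.
Variables (R : realType) (n : nat).
Implicit Types p : mpoly n R.

(* mmeasure mdeg p is 1 + the total degree, and 0 for p = 0;
   hence pdeg 0 = 0. *)
Definition pdeg p : nat := (mmeasure mdeg p).-1.

Definition peval p (x : 'rV[R]_n) : R := meval (fun j => x ord0 j) p.

(* p^infty *)
Definition asympt p (x : 'rV[R]_n) : R :=
  lim (peval p (lambda *: x) / lambda ^+ pdeg p @[lambda --> +oo]).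

End Polynomials.

Section VectorPolynomials.
Variables (R : realType) (n s : nat).
Implicit Types p g : 'I_s -> mpoly n R.

Definition vpeval p (x : 'rV[R]_n) : 'rV[R]_s := \row_i peval (p i) x.

Definition vasympt p (x : 'rV[R]_n) : 'rV[R]_s := \row_i asympt (p i) x.

Definition vpadd p g : 'I_s -> mpoly n R := fun i => p i + g i.

Definition in_Pd (d : 'I_s -> nat) g : Prop := forall i, (pdeg (g i) <= d i)%N.

(* Monomials outside the support have zero coefficient, so this is the
   Euclidean norm of all the coefficients of g, whatever the ambient P_d. *)
Definition vpnorm g : R :=
  Num.sqrt (\sum_(i < s) \sum_(m <- msupp (g i))
              mcoeff m (g i) ^+ 2).

End VectorPolynomials.

Section Pareto.
Variables (R : realType) (n s : nat).
Implicit Types (C : set 'rV[R]_n) (h : 'rV[R]_n -> 'rV[R]_s).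

Definition orthant : set 'rV[R]_s := [set y : 'rV[R]_s | forall i, 0 <= y ord0 i].

Definition sol_s C h : set 'rV[R]_n :=
  [set xs : 'rV[R]_n | C xs /\ forall x, C x ->
     ~ ((-%R @` orthant) `\` [set 0]) (h x - h xs)].

Definition sol_w C h : set 'rV[R]_n :=
  [set xs : 'rV[R]_n | C xs /\ forall x, C x ->
     ~ (-%R @` interior orthant) (h x - h xs)].

End Pareto.

Definition asymptotic_cone (R : realType) (n : nat) (K : set 'rV[R]_n) :
    set 'rV[R]_n :=
  [set v : 'rV[R]_n | exists (t : nat -> R) (x : nat -> 'rV[R]_n),
     [/\ t k @[k --> \oo] --> +oo,
         forall k, K (x k)
       & (t k)^-1 *: x k @[k --> \oo] --> v]].

(* Main.v *)
(** At a point [t w] the component [i] of [f + g] differs from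
    [t ^ d_i f_i^infty(w)] by at most [(M + N |g| t) t ^ (d_i - 1)], uniformly
    for [w] in a ball.
    (i) Since [0] is not weakly efficient in the cone, [f^infty] is negative in
    all components at some [v] in the cone.  Along points of [K] approaching
    the direction [v] all components of [f + g] tend to [-oo].
    (ii) If [0] is the only weakly efficient point of the cone, every component
    of [f^infty] is positive on the nonzero vectors of the cone.  By compactness
    of the sphere every component of [f + g] is then coercive on [K]: an
    efficient point is obtained by minimising the sum of the components over a
    sublevel set, and the weakly efficient set is closed and bounded. *)

Require Import Defs.
From HB Require Import structures.
From mathcomp Require Import all_boot all_order all_algebra.
From mathcomp Require Import all_classical all_reals all_analysis.
From mathcomp Require Import -(notations) mpoly.
From mathcomp Require Import ring lra.


Set Implicit Arguments.
Unset Strict Implicit.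
Unset Printing Implicit Defensive.

Import Order.TTheory GRing.Theory Num.Theory.
Import numFieldNormedType.Exports.

Local Open Scope classical_set_scope.
Local Open Scope ring_scope.

(** * Growth of a polynomial at scaled points and the explicit form of its asymptotic polynomial *)

Section PolynomialGrowth.
Variables (R : realType) (n : nat).
Implicit Types (p : mpoly n R) (m : multinom n) (x w : 'rV[R]_n).

Definition monom m x : R := \prod_i x ord0 i ^+ m i.

(** For [d = pdeg p >= 1] this is [asympt p] without the limit (see [asymptE]); continuity and
    homogeneity are read off from it. *)
Definition top_form (d : nat) p x : R :=
  \sum_(m <- msupp p | mdeg m == d) mcoeff m p * monom m x.

Definition l1norm p : R := \sum_(m <- msupp p) `|mcoeff m p|.

Lemma pevalE p x : peval p x = \sum_(m <- msupp p) mcoeff m p * monom m x.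
Proof. by rewrite /peval mevalE. Qed.

Lemma le_coord_norm x i : `|x ord0 i| <= `|x|.
Proof.
rewrite {2}/Num.norm/= mx_normrE.
exact: (le_bigmax _ (fun ij : 'I_1 * 'I_n => `|x ij.1 ij.2|) (ord0, i)).
Qed.

Lemma monomZ m t x : monom m (t *: x) = t ^+ mdeg m * monom m x.
Proof.
rewrite /monom mdegE -prodrXr -big_split/=.
by apply: eq_bigr => i _; rewrite mxE exprMn.
Qed.

Lemma le_norm_monom m x B : `|x| <= B -> `|monom m x| <= B ^+ mdeg m.
Proof.
move=> xB; rewrite /monom normr_prod mdegE -prodrXr.
apply: ler_prod => i _; rewrite normr_ge0 normrX/=.
by rewrite lerXn2r ?nnegrE// ?(le_trans _ xB)// le_coord_norm.
Qed.

Lemma continuous_monom m : continuous (monom m).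
Proof.
apply: continuous_big => [|i _]; first exact: mul_continuous.
move=> x; apply: (@continuous_comp _ _ _
    (fun y : 'rV[R]_n => y ord0 i) (fun z => z ^+ m i)).
  exact: coord_continuous.
exact: exprn_continuous.
Qed.

Lemma continuous_sum_monom p (P : pred (multinom n)) :
  continuous (fun x => \sum_(m <- msupp p | P m) mcoeff m p * monom m x).
Proof.
apply: continuous_big => [|m _]; first exact: add_continuous.
move=> x; apply: continuousM; first exact: cst_continuous.
exact: continuous_monom.
Qed.

Lemma continuous_peval p : continuous (peval p).
Proof.
rewrite (_ : peval p = fun x => \sum_(m <- msupp p | true) mcoeff m p * monom m x);
  last by apply/funext => x; exact: pevalE.
exact: (continuous_sum_monom (P := predT)).
Qed.

Lemma continuous_top_form d p : continuous (top_form d p).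
Proof. exact: continuous_sum_monom. Qed.

Lemma top_formZ d p t x : top_form d p (t *: x) = t ^+ d * top_form d p x.
Proof.
rewrite /top_form big_distrr/=; apply: eq_bigr => m /eqP md.
by rewrite monomZ md mulrCA.
Qed.

Lemma pdeg_ge p m : m \in msupp p -> (mdeg m <= pdeg p)%N.
Proof. by move=> /msize_mdeg_lt; rewrite /pdeg; case: mmeasure. Qed.

Lemma l1norm_ge0 p : 0 <= l1norm p.
Proof. exact: sumr_ge0. Qed.

(** A monomial of degree [k] is at most [B ^+ k * t ^+ k], and both exponents may be raised since
    [B] and [t] are at least 1. Keeping [e] apart from [d] serves both the whole polynomial
    ([e = d]) and its part below the top degree ([e = d - 1]). *)
Lemma le_norm_sum_monom p (P : pred (multinom n)) d e t w B :
  (forall m, m \in msupp p -> P m -> (mdeg m <= e)%N) -> (e <= d)%N ->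
  1 <= t -> 1 <= B -> `|w| <= B ->
  `|\sum_(m <- msupp p | P m) mcoeff m p * monom m (t *: w)|
    <= l1norm p * (B ^+ d * t ^+ e).
Proof.
move=> Pe ed t1 B1 wB; apply: le_trans (ler_norm_sum _ _ _) _.
rewrite /l1norm big_distrl/= big_mkcond/= big_seq [leRHS]big_seq.
have t0 : 0 <= t := le_trans ler01 t1; have B0 : 0 <= B := le_trans ler01 B1.
apply: ler_sum => m mp; case: ifPn => [Pm|_]; last first.
  by rewrite mulr_ge0// mulr_ge0// exprn_ge0.
rewrite normrM ler_wpM2l// monomZ normrM normrX (ger0_norm t0) mulrC.
apply: ler_pM; rewrite ?exprn_ge0//.
  apply: le_trans (le_norm_monom _ wB) _.
  by rewrite ler_weXn2l// (leq_trans _ ed)// Pe.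
by rewrite ler_weXn2l// Pe.
Qed.

Lemma le_norm_peval p d t w B : (pdeg p <= d)%N ->
  1 <= t -> 1 <= B -> `|w| <= B ->
  `|peval p (t *: w)| <= l1norm p * (B ^+ d * t ^+ d).
Proof.
move=> pd; rewrite pevalE; apply: le_norm_sum_monom => // m mp _.
exact: leq_trans (pdeg_ge mp) pd.
Qed.

Lemma le_norm_peval_sub_top p t w B : (1 <= pdeg p)%N ->
  1 <= t -> 1 <= B -> `|w| <= B ->
  `|peval p (t *: w) - t ^+ pdeg p * top_form (pdeg p) p w|
    <= l1norm p * (B ^+ pdeg p * t ^+ (pdeg p).-1).
Proof.
move=> d1 t1 B1 wB; rewrite -top_formZ pevalE /top_form.
rewrite (bigID (fun m => mdeg m == pdeg p))/= addrAC subrr add0r.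
apply: le_norm_sum_monom => //; last exact: leq_pred.
move=> m /pdeg_ge; rewrite leq_eqVlt => /orP[->//|mp _].
by rewrite -ltnS prednK.
Qed.

Lemma asymptE p x : (1 <= pdeg p)%N -> asympt p x = top_form (pdeg p) p x.
Proof.
move=> d1; apply: cvg_lim => //; apply/cvgrPdist_le => e e0.
pose B := 1 + `|x|; have B1 : 1 <= B by rewrite lerDl.
have xB : `|x| <= B by rewrite lerDr.
pose C := l1norm p * B ^+ pdeg p.
near=> t.
have t1 : 1 <= t by near: t; exact: nbhs_pinfty_ge.
have t0 : 0 < t := lt_le_trans ltr01 t1.
(* After division by [t ^+ pdeg p] the error is at most [C / t]. *)
have tC : C / e <= t by near: t; apply: nbhs_pinfty_ge; exact: num_real.
have tn0 : t ^+ pdeg p != 0 by rewrite expf_neq0// gt_eqF.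
rewrite distrC -[X in _ - X](mulfK tn0) -mulrBl normrM normfV.
rewrite (ger0_norm (exprn_ge0 _ (ltW t0))) ler_pdivrMr ?exprn_gt0//.
rewrite [top_form _ _ _ * _]mulrC.
apply: le_trans (le_norm_peval_sub_top d1 t1 B1 xB) _.
rewrite mulrA -/C -[in leRHS](prednK d1) exprS mulrA.
rewrite ler_wpM2r ?exprn_ge0 ?(ltW t0)//.
by rewrite [leRHS]mulrC -ler_pdivrMr.
Unshelve. all: by end_near. Qed.

End PolynomialGrowth.

(** * Bounds on [f + g] uniform in the perturbation [g] *)

Section Perturbation.
Variables (R : realType) (n s : nat).
Implicit Types (g : 'I_s -> mpoly n R).

Lemma le_coef_vpnorm g i m : `|mcoeff m (g i)| <= vpnorm g.
Proof.
have [mg|mg] := boolP (m \in msupp (g i)); last first.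
  by rewrite memN_msupp_eq0// normr0 sqrtr_ge0.
rewrite -sqrtr_sqr; apply: ler_wsqrtr.
rewrite (bigD1 i)//= (bigD1_seq m)/= ?msupp_uniq// -addrA lerDl.
by rewrite addr_ge0// ?sumr_ge0// => *; rewrite ?sumr_ge0// => *; exact: sqr_ge0.
Qed.

Lemma size_msupp_le (p : mpoly n R) d : (pdeg p <= d)%N ->
  (size (msupp p) <= #|{: bmultinom n d.+1}|)%N.
Proof.
move=> pd; rewrite cardE -(size_map (@bmnm n d.+1)).
apply: uniq_leq_size; first exact: msupp_uniq.
move=> m mp; have md : (mdeg m < d.+1)%N.
  by rewrite ltnS (leq_trans (pdeg_ge mp)).
by apply/mapP; exists (BMultinom md) => //; rewrite mem_enum.
Qed.

(** One half of the equivalence of norms on the finite-dimensional space P_d: each coefficient is at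
    most [vpnorm g], and the number of coefficients is bounded independently of [g]. Summing these
    numbers over [i] gives one constant for all components. *)
Lemma l1norm_le_vpnorm (d : 'I_s -> nat) :
  exists2 N : R, 0 <= N & forall g i, in_Pd d g -> l1norm (g i) <= N * vpnorm g.
Proof.
exists (\sum_i #|{: bmultinom n (d i).+1}|%:R) => [|g i gd].
  by apply: sumr_ge0.
have: l1norm (g i) <= \sum_(m <- msupp (g i)) vpnorm g.
  by apply: ler_sum => m _; exact: le_coef_vpnorm.
move/le_trans; apply.
rewrite big_const_seq count_predT iter_addr_0 -mulr_natl.
rewrite ler_wpM2r ?sqrtr_ge0//.
apply: (@le_trans _ _ #|{: bmultinom n (d i).+1}|%:R).
  by rewrite ler_nat size_msupp_le.
by rewrite (bigD1 i)//= lerDl sumr_ge0.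
Qed.

(** [M] accounts for the lower-order terms of [f]. The term [N * vpnorm g * t] has an extra factor
    [t] because [g i] may itself have degree [d i]; only the smallness of [g] controls it. *)
Lemma perturbation_bound (f : 'I_s -> mpoly n R) (d : 'I_s -> nat) :
  (forall i, pdeg (f i) = d i) -> (forall i, (1 <= d i)%N) ->
  exists M N : R, [/\ 0 <= M, 0 <= N & forall g i t w B, in_Pd d g ->
    1 <= t -> 1 <= B -> `|w| <= B ->
    `|vpeval (vpadd f g) (t *: w) ord0 i - t ^+ d i * vasympt f w ord0 i|
      <= (M + N * vpnorm g * t) * (B ^+ d i * t ^+ (d i).-1)].
Proof.
move=> fd d1; have [N N0 lN] := l1norm_le_vpnorm d.
exists (\sum_i l1norm (f i)), N; split => //.
  by apply: sumr_ge0 => i _; exact: l1norm_ge0.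
move=> g i t w B gd t1 B1 wB.
have t0 : 0 <= t := le_trans ler01 t1; have B0 : 0 <= B := le_trans ler01 B1.
rewrite !mxE /vpadd asymptE ?fd// /peval mevalD addrAC.
apply: le_trans (ler_normD _ _) _.
rewrite mulrDl; apply: lerD.
  have := @le_norm_peval_sub_top _ _ (f i) t w B; rewrite fd => /(_ (d1 i) t1 B1 wB).
  move/le_trans; apply; rewrite ler_wpM2r ?mulr_ge0 ?exprn_ge0//.
  by rewrite (bigD1 i)//= lerDl sumr_ge0// => j _; exact: l1norm_ge0.
apply: le_trans (le_norm_peval (gd i) t1 B1 wB) _.
have -> : t ^+ d i = t * t ^+ (d i).-1 by rewrite -exprS prednK.
rewrite [leLHS](_ : _ = l1norm (g i) * (t * (B ^+ d i * t ^+ (d i).-1))); last by ring.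
by rewrite -[leRHS]mulrA ler_wpM2r ?lN// !mulr_ge0 ?exprn_ge0.
Qed.

End Perturbation.

(** * Pareto efficiency: componentwise forms, existence and closedness *)

Section ParetoPoints.
Variables (R : realType) (n s : nat).
Implicit Types (C : set 'rV[R]_n) (h : 'rV[R]_n -> 'rV[R]_s).

Lemma exists_uniform_lb (F : 'I_s -> R) : (forall i, 0 < F i) ->
  exists2 c, 0 < c & forall i, c <= F i.
Proof.
move=> F0.
have FF : \forall c \near 0^'+, forall i, c <= F i.
  by apply: filter_forall => i; exact: nbhs_right_le.
near (0 : R)^'+ => c; exists c; last by near: c.
by near: c; exact: nbhs_right_gt.
Unshelve. all: by end_near. Qed.

Lemma interior_orthantP (y : 'rV[R]_s) :
  interior (@orthant R s) y <-> forall i, 0 < y ord0 i.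
Proof.
split=> [yo i|y0].
  move: yo => /nbhs_ballP[e /= e0 /(_ (y - const_mx (e / 2)))].
  rewrite mx_norm_ball => yo.
  (* Lowering all coordinates by [e / 2] stays in the sup-norm ball, hence in the orthant, so each
     coordinate of [y] is at least [e / 2]. *)
  have /yo/(_ i) : ball_ Num.norm y e (y - const_mx (e / 2)).
    rewrite /ball_/= opprB addrC subrK; apply: le_lt_trans (_ : e / 2 < e).
      rewrite {1}/Num.norm/= mx_normrE; apply: bigmax_le => [|ij _].
        by rewrite ltW// divr_gt0.
      by rewrite mxE ger0_norm// ltW// divr_gt0.
    by rewrite ltr_pdivrMr// ltr_pMr// ltr1n.
  by rewrite !mxE subr_ge0; apply: lt_le_trans; rewrite divr_gt0.
have [c c0 cy] := exists_uniform_lb y0.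
apply/nbhs_ballP; exists c => //= z; rewrite mx_norm_ball /ball_/= => yz i.
have := le_lt_trans (le_coord_norm (y - z) i) yz; rewrite !mxE => /ltr_normlW.
by have := cy i; lra.
Qed.

Lemma sol_wP C h xs : sol_w C h xs <->
  C xs /\ forall x, C x -> ~ forall i, h x ord0 i < h xs ord0 i.
Proof.
have E x : (-%R @` interior (@orthant R s)) (h x - h xs) <->
    forall i, h x ord0 i < h xs ord0 i.
  split=> [[y /interior_orthantP y0 yE] i|lt].
    have := congr1 (fun z : 'rV[R]_s => z ord0 i) yE; have := y0 i.
    by rewrite !mxE; lra.
  exists (h xs - h x); last by rewrite opprB.
  by apply/interior_orthantP => i; rewrite !mxE subr_gt0.
by split=> -[Cxs H]; split=> // x Cx /E; exact: H.
Qed.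

(** For [s = 0] strict domination is vacuous, so every point dominates itself. *)
Lemma sol_w_gt0 C h xs : sol_w C h xs -> (0 < s)%N.
Proof.
move=> /sol_wP[Cxs /(_ xs Cxs) H]; rewrite lt0n; apply/eqP => s0; apply: H.
by move=> i; have := ltn_ord i; rewrite {2}s0.
Qed.

Lemma sol_sP C h xs : C xs ->
  (forall x, C x -> (forall i, h x ord0 i <= h xs ord0 i) -> h x = h xs) ->
  sol_s C h xs.
Proof.
move=> Cxs H; split=> // x Cx [[y y0 yE]]; apply.
rewrite /= (H x Cx) ?subrr// => i.
have := congr1 (fun z : 'rV[R]_s => z ord0 i) yE; have := y0 i.
by rewrite !mxE; lra.
Qed.

Lemma sol_s_sub_sol_w C h : (0 < s)%N -> sol_s C h `<=` sol_w C h.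
Proof.
move=> s0 xs [Cxs H]; split=> // x Cx [y yo yE]; apply: (H x Cx); split.
  by exists y => //; exact: interior_subset.
move=> /= z0; move: yo => /interior_orthantP/(_ (Ordinal s0)).
by rewrite -[y]opprK yE z0 oppr0 mxE ltxx.
Qed.

Definition sublevel C h v : set 'rV[R]_n :=
  [set x | C x /\ forall i, h x ord0 i <= h v ord0 i].

Lemma exists_efficient_below C h v : closed C -> C v ->
  (forall i, continuous (fun x => h x ord0 i)) -> bounded_set (sublevel C h v) ->
  exists2 u, sol_s C h u & forall i, h u ord0 i <= h v ord0 i.
Proof.
move=> Ccl Cv hc bS.
have Scl : closed (sublevel C h v).
  rewrite (_ : sublevel C h v =
    C `&` \bigcap_(i in setT) ((fun x => h x ord0 i) @^-1` [set r | r <= h v ord0 i])).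
    apply: closedI => //; apply: closed_bigI => i _.
    move/continuous_closedP: (hc i); apply; exact: closed_le.
  by apply/seteqP; split=> x /= [Cx H]; split=> // i; [move=> _|]; exact: H.
have Sv : sublevel C h v v by split.
have sc : continuous (fun x => \sum_(i < s) h x ord0 i).
  by apply: continuous_big => [|i _]; [exact: add_continuous|exact: hc].
have [u] := EVT_min_rV (ex_intro _ v Sv) (bounded_closed_compact bS Scl)
  (continuous_subspaceT sc).
rewrite inE => -[Cu uv] umin; exists u => //; apply: sol_sP => // x Cx xu.
have /umin : x \in sublevel C h v.
  by rewrite inE; split=> // i; exact: le_trans (xu i) (uv i).
(* The differences [h u - h x] are nonnegative with sum at most 0, so they all vanish. *)
rewrite -subr_le0 -sumrB => sum_le0.
have sum_eq0 : \sum_(i < s) (h u ord0 i - h x ord0 i) = 0.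
  by apply/eqP; rewrite eq_le sum_le0 sumr_ge0// => i _; rewrite subr_ge0.
apply/rowP => i; apply/eqP; rewrite eq_sym -subr_eq0; apply/eqP.
by move: i (erefl true); apply/psumr_eq0P => // i _; rewrite subr_ge0.
Qed.

Lemma closed_sol_w C h : closed C ->
  (forall i, continuous (fun x => h x ord0 i)) -> closed (sol_w C h).
Proof.
move=> Ccl hc.
(* For each [x] the points strictly dominated by [x] form a finite intersection of open sets. *)
rewrite (_ : sol_w C h = C `&` \bigcap_(x in C)
    ~` (\bigcap_(i in [set: 'I_s])
          ((fun y => h y ord0 i) @^-1` [set r | h x ord0 i < r]))).
  apply: closedI => //; apply: closed_bigI => x _; rewrite closedC.
  rewrite openE => y yx; have: \forall z \near y, forall i, h x ord0 i < h z ord0 i.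
    apply: (@filter_forall _ _ (fun i z => h x ord0 i < h z ord0 i) (nbhs y)) => i.
    apply: (hc i y [set r | h x ord0 i < r]).
    by apply: open_nbhs_nbhs; split; [exact: open_gt|exact: yx].
  by apply: filterS => z zx i _; exact: zx.
apply/seteqP; split=> xs.
  move=> /sol_wP[Cxs H]; split=> // x Cx /= lt.
  by apply: (H x Cx) => i; exact: lt.
move=> [Cxs H]; apply/sol_wP; split=> // x Cx lt.
by apply: (H x Cx) => i _; exact: lt.
Qed.

End ParetoPoints.

(** * The asymptotic cone and compactness of directions *)

Section AsymptoticCone.
Variables (R : realType) (n : nat).
Implicit Types K : set 'rV[R]_n.

(** Replaces sequences by single approximations; conversely, a sequence is chosen with [T = k] and
    [e = 1 / (k + 1)]. *)
Lemma asymptotic_coneP K v : asymptotic_cone K v <->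
  forall e T, 0 < e -> exists t x, [/\ T <= t, K x & `|v - t^-1 *: x| < e].
Proof.
split=> [[t [x [tT Kx tv]]] e T e0|H].
  move/cvgryPge/(_ T): tT => tT; move/cvgrPdist_lt/(_ e e0): tv => tv.
  by have [k [Tk vk]] := filter_ex (filterI tT tv); exists (t k), (x k).
have /choice[tx txP] k : exists y : R * 'rV[R]_n,
    [/\ k%:R <= y.1, K y.2 & `|v - y.1^-1 *: y.2| < k.+1%:R^-1].
  have e0 : 0 < k.+1%:R^-1 :> R by rewrite invr_gt0.
  by have [t [x [? ? ?]]] := H k.+1%:R^-1 k%:R e0; exists (t, x).
exists (fun k => (tx k).1), (fun k => (tx k).2); split => [|k|].
- apply/cvgryPge => A; near=> k; have [kt _ _] := txP k.
  apply: le_trans kt; near: k.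
  by have /cvgryPge := @cvgr_idn R; exact.
- by have [] := txP k.
- apply/cvgrPdist_lt => e e0; near=> k; have [_ _ /lt_trans] := txP k; apply.
  by near: k; exact: (near_infty_natSinv_lt (PosNum e0)).
Unshelve. all: by end_near. Qed.

Lemma closed_asymptotic_cone K : closed (asymptotic_cone K).
Proof.
move=> v clv; apply/asymptotic_coneP => e T e0.
have e20 : 0 < e / 2 by rewrite divr_gt0.
have [u [/asymptotic_coneP/(_ _ T e20)[t [x [Tt Kx ux]]]]] :=
  clv _ (nbhsx_ballx v _ e20).
rewrite -ball_normE /= => vu; exists t, x; split=> //.
rewrite -[v](subrK u) -addrA [e]splitr.
by apply: le_lt_trans (ler_normD _ _) _; exact: ltrD.
Qed.

(** If [u / t] is close to [v] and [x / r] is close to [u], then [x / (t * r)] is close to [v],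
    since dividing by [t >= 1] does not enlarge the second error. It allows [normalized_lb] to be
    applied to the cone itself. *)
Lemma asymptotic_cone_idem K :
  asymptotic_cone (asymptotic_cone K) `<=` asymptotic_cone K.
Proof.
move=> v /asymptotic_coneP H; apply/asymptotic_coneP => e T e0.
have e20 : 0 < e / 2 by rewrite divr_gt0.
have [t [u [t1 /asymptotic_coneP/(_ _ (Num.max 1 T) e20)[r [x [rT Kx ux]]] vu]]] :=
  H (e / 2) 1 e20.
move: rT; rewrite ge_max => /andP[r1 Tr].
have t0 : 0 < t := lt_le_trans ltr01 t1.
have r0 : 0 < r := lt_le_trans ltr01 r1.
exists (t * r), x; split=> //.
  by apply: le_trans Tr _; rewrite ler_peMl// ltW.
rewrite -[v](subrK (t^-1 *: u)) -addrA [e]splitr.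
apply: le_lt_trans (ler_normD _ _) _; apply: ltrD => //.
rewrite invfM -scalerA -scalerBr normrZ; apply: le_lt_trans ux.
by rewrite ler_piMl// normfV gtr0_norm// invf_le1.
Qed.

Lemma asymptotic_cone0 K : K !=set0 -> asymptotic_cone K 0.
Proof.
move=> [x Kx]; apply/asymptotic_coneP => e T e0.
have x0 : 0 <= `|x| / e by rewrite divr_ge0// ltW.
pose t := Num.max T (`|x| / e + 1); have t0 : 0 < t.
  by rewrite lt_max (ltr_wpDl x0)// orbT.
exists t, x; split=> //; first by rewrite le_max lexx.
rewrite sub0r normrN normrZ normfV gtr0_norm// mulrC ltr_pdivrMr// mulrC.
by rewrite -ltr_pdivrMr// lt_max ltrDl ltr01 orbT.
Qed.

Lemma bounded_set_lt (A : set 'rV[R]_n) (T : R) :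
  (forall x, A x -> `|x| < T) -> bounded_set A.
Proof.
move=> AT; exists T; split=> [|M TM x /AT/ltW/le_trans]; first exact: num_real.
by apply; exact: ltW.
Qed.

(* Otherwise normalised points of K with norms tending to infinity accumulate
   at a unit vector of the asymptotic cone where phi <= 0. *)
Lemma normalized_lb K (phi : 'rV[R]_n -> R) : continuous phi ->
  (forall v, asymptotic_cone K v -> `|v| = 1 -> 0 < phi v) ->
  \forall e \near 0^'+, forall x, K x -> e^-1 <= `|x| -> e <= phi (`|x|^-1 *: x).
Proof.
move=> phic phi0.
(* The property passes to smaller [e]: fewer points are concerned and the bound is weaker. The
   filter form lets finitely many such bounds be combined. *)
suff [e0 e00 He0] : exists2 e, 0 < e &
    forall x, K x -> e^-1 <= `|x| -> e <= phi (`|x|^-1 *: x).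
  near=> e => x Kx ex.
  have ep : 0 < e by near: e; exact: nbhs_right_gt.
  have ee0 : e <= e0 by near: e; exact: nbhs_right_le.
  by rewrite (le_trans ee0)// He0// (le_trans _ ex)// lef_pV2.
apply: contrapT => no.
have /choice[x xP] k : exists x,
    [/\ K x, k.+1%:R <= `|x| & phi (`|x|^-1 *: x) < k.+1%:R^-1].
  apply: contrapT => nox; apply: no.
  exists k.+1%:R^-1; first by rewrite invr_gt0.
  move=> x Kx; rewrite invrK => kx; rewrite leNgt; apply/negP => phix.
  by apply: nox; exists x.
have x0 k : 0 < `|x k|.
  by have [_ kx _] := xP k; exact: lt_le_trans kx.
pose w k := `|x k|^-1 *: x k.
pose S : set 'rV[R]_n := [set v | `|v| = 1].
have Sw k : S (w k).
  by rewrite /S/= normrZ normfV normr_id mulVf// gt_eqF.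
have Scl : closed S.
  have /continuous_closedP/(_ _ (@closed_eq R 1)) := @norm_continuous R 'rV[R]_n.
  exact.
have Sbd : bounded_set S.
  by apply: (@bounded_set_lt S 2) => v /= ->; rewrite ltr1n.
have Sw_near : (w @ \oo) S by exists 0%N => // k _; exact: Sw.
have [v [Sv clv]] := bounded_closed_compact Sbd Scl _ Sw_near.
(* Clustering at [v] yields arbitrarily late terms in any neighbourhood, so no subsequence is
   extracted. *)
have meet (N : nat) (B : set 'rV[R]_n) : nbhs v B ->
    exists2 k, (N <= k)%N & B (w k).
  move=> vB; have FN : (w @ \oo) [set w k | k in [set k | (N <= k)%N]].
    by exists N => // k Nk; exists k.
  by have [_ [[k Nk <-] Bk]] := clv _ _ FN vB; exists k.
have Kv : asymptotic_cone K v.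
  apply/asymptotic_coneP => e T e0.
  have [k Nk] := meet (Num.truncn `|T|) _ (nbhsx_ballx v _ e0).
  rewrite -ball_normE /= => vw; have [Kx kx _] := xP k.
  exists `|x k|, (x k); split=> //; apply: le_trans kx.
  apply: le_trans (ler_norm T) _; apply: le_trans (ltW (truncnS_gt _)) _.
  by rewrite ler_nat ltnS.
have phiv := phi0 v Kv Sv.
(* For late [k] with [w k] near [v], [phi (w k)] is both above [phi v / 2] and below
   [1 / (k + 1) < phi v / 2]. *)
have [N _ HN] := near_infty_natSinv_lt (PosNum (divr_gt0 phiv (ltr0Sn R 1))).
have [|k Nk] := meet N [set u | phi v / 2 < phi u].
  apply: (phic v [set r | phi v / 2 < r]).
  apply: open_nbhs_nbhs; split; first exact: open_gt.
  by rewrite /= ltr_pdivrMr// ltr_pMr// ltr1n.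
have [_ _ /lt_trans] := xP k => /(_ _ (HN k Nk))/=.
by move=> /lt_trans/[apply]; rewrite ltxx.
Unshelve. all: by end_near. Qed.

End AsymptoticCone.

(** * Stability of the solution sets under small perturbations *)

Section Stability.
Variables (R : realType) (n s : nat) (K : set 'rV[R]_n).
Variables (f : 'I_s -> mpoly n R) (d : 'I_s -> nat).
Hypotheses (K_nonempty : K !=set0) (K_closed : closed K).
Hypotheses (f_deg : forall i, pdeg (f i) = d i) (d_ge1 : forall i, (1 <= d i)%N).

Let vasymptE w i : vasympt f w ord0 i = top_form (d i) (f i) w.
Proof. by rewrite mxE asymptE f_deg. Qed.

Lemma vasymptZ t w i :
  vasympt f (t *: w) ord0 i = t ^+ d i * vasympt f w ord0 i.
Proof. by rewrite !vasymptE top_formZ. Qed.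

Lemma vasympt0 i : vasympt f 0 ord0 i = 0.
Proof. by rewrite -(scale0r 0) vasymptZ expr0n gtn_eqF ?mul0r. Qed.

Lemma continuous_vasympt i : continuous (fun w => vasympt f w ord0 i).
Proof.
rewrite (_ : (fun w => _) = top_form (d i) (f i)); first exact: continuous_top_form.
by apply/funext => w; exact: vasymptE.
Qed.

Lemma continuous_vpeval (g : 'I_s -> mpoly n R) i :
  continuous (fun x => vpeval g x ord0 i).
Proof.
rewrite (_ : (fun x => _) = peval (g i)); first exact: continuous_peval.
by apply/funext => x; rewrite mxE.
Qed.

Lemma stability_empty :
  sol_w (asymptotic_cone K) (vasympt f) = set0 ->
  exists2 eps : R, 0 < eps &
    forall g : 'I_s -> mpoly n R, in_Pd d g -> vpnorm g < eps ->
      sol_w K (vpeval (vpadd f g)) = set0.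
Proof.
move=> sol0.
have [v Kv v0] : exists2 v, asymptotic_cone K v &
    forall i, vasympt f v ord0 i < 0.
  apply: contrapT => nov; suff : set0 (0 : 'rV[R]_n) by [].
  rewrite -sol0; apply/sol_wP; split; first exact: asymptotic_cone0.
  by move=> v Kv lt; apply: nov; exists v => // i; rewrite -(vasympt0 i).
have [M [N [M0 N0 bound]]] := perturbation_bound f_deg d_ge1.
pose B := 1 + `|v|; have B1 : 1 <= B by rewrite lerDl.
have B0 : 0 <= B := le_trans ler01 B1.
(* Thus [vasympt f v] is [-4 q]. Near [v] it stays below [-2 q], the perturbation costs at most [q],
   and the remaining [- q * t] absorbs the lower-order terms and the value at [xs]. *)
pose q i := - vasympt f v ord0 i / 4.
have q0 i : 0 < q i by rewrite divr_gt0// oppr_gt0.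
have NB0 i : 0 <= N * B ^+ d i by rewrite mulr_ge0// exprn_ge0.
(* Chosen so that [N * vpnorm g * B ^+ d i <= q i]; the [+ 1] keeps the denominator positive. *)
have [eps eps0 epsq] : exists2 eps, 0 < eps &
    forall i, eps <= q i / (N * B ^+ d i + 1).
  by apply: exists_uniform_lb => i; rewrite divr_gt0// ltr_wpDl.
exists eps => // g gd geps; apply/seteqP; split=> // xs /sol_wP[Kxs H].
pose A i := `|vpeval (vpadd f g) xs ord0 i| + 1.
pose T := 1 + \sum_i (M * B ^+ d i + A i) / q i.
have near_v : \forall w \near v, forall i, vasympt f w ord0 i < - 2 * q i.
  apply: (@filter_forall _ _ (fun i w => vasympt f w ord0 i < - 2 * q i) (nbhs v)) => i.
  apply: (continuous_vasympt (x := v) (t := [set r | r < - 2 * q i])).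
  apply: open_nbhs_nbhs; split; first exact: open_lt.
  by rewrite /= /q; have := v0 i; lra.
have /nbhs_ballP[e /= e0 ev] := near_v.
(* Distance below [e] gives the sign estimate of [near_v], distance below 1 gives [|w| <= B]. *)
have [t [x [Tt Kx]]] := (asymptotic_coneP K v).1 Kv (Num.min e 1) T
  (ltac:(by rewrite lt_min e0 ltr01)).
set w := t^-1 *: x; rewrite lt_min => /andP[vwe vw1].
have {ev}w0 i : vasympt f w ord0 i < - 2 * q i.
  by apply: ev; rewrite -ball_normE.
have AM0 i : 0 <= (M * B ^+ d i + A i) / q i.
  by rewrite divr_ge0 ?(ltW (q0 i)) ?addr_ge0 ?mulr_ge0 ?exprn_ge0.
have t1 : 1 <= t by rewrite (le_trans _ Tt)// lerDl sumr_ge0.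
have t0 : 0 < t := lt_le_trans ltr01 t1.
have wB : `|w| <= B.
  rewrite -(subrK v w) (le_trans (ler_normD _ _))// lerD2r.
  by rewrite -opprB normrN ltW.
have xE : x = t *: w by rewrite scalerA divff ?scale1r// gt_eqF.
apply: (H x Kx) => i.
have tA : M * B ^+ d i + A i <= q i * t.
  rewrite [leRHS]mulrC -ler_pdivrMr//; apply: le_trans Tt.
  by rewrite /T (bigD1 i)// [leRHS]addrCA lerDl addr_ge0// sumr_ge0.
have NBq : N * vpnorm g * B ^+ d i <= q i.
  rewrite mulrAC; apply: (@le_trans _ _ ((N * B ^+ d i + 1) * eps)).
    apply: ler_pM; rewrite ?sqrtr_ge0// ?lerDl ?ltW//.
  by rewrite mulrC -ler_pdivlMr// ltr_wpDl.
have := bound g i t w B gd t1 B1 wB; rewrite -xE => /ler_normlW.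
have -> : t ^+ d i = t * t ^+ (d i).-1 by rewrite -exprS prednK.
have P1 : 1 <= t ^+ (d i).-1 by rewrite exprn_ege1.
move: (t ^+ _) P1 => P P1.
have Axs : 1 - A i <= vpeval (vpadd f g) xs ord0 i.
  by rewrite /A opprD addrCA subrr addr0 lerNl -normrN ler_norm.
have A1 : 1 <= A i by rewrite lerDr.
rewrite lerBlDl => /le_lt_trans; apply; apply: lt_le_trans Axs.
apply: (@le_lt_trans _ _ (- A i)); last by rewrite ltrDr.
apply: (@le_trans _ _ (P * - A i)); last by nra.
have S1 : t * vasympt f w ord0 i <= t * (- 2 * q i) by rewrite ler_pM2l// ltW.
have S2 : N * vpnorm g * B ^+ d i * t <= q i * t by rewrite ler_pM2r.
rewrite [leLHS](_ : _ = P * (t * vasympt f w ord0 i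
    + (M * B ^+ d i + N * vpnorm g * B ^+ d i * t))); last by ring.
by rewrite ler_pM2l ?(lt_le_trans ltr01)//; lra.
Qed.

(* The set of points of the cone dominating v is bounded, because some
   component of f^infty is positive at each nonzero vector; an efficient point
   of the cone dominating v is then weakly efficient, hence 0. *)
Lemma vasympt_gt0 : sol_w (asymptotic_cone K) (vasympt f) = [set 0] ->
  forall v, asymptotic_cone K v -> v != 0 -> forall i, 0 < vasympt f v ord0 i.
Proof.
set C := asymptotic_cone K => sol0.
have /sol_wP[_ no_neg] : sol_w C (vasympt f) 0 by rewrite sol0.
have s0 : (0 < s)%N by apply: (@sol_w_gt0 _ _ _ C (vasympt f) 0); rewrite sol0.
have dominated v : C v -> v != 0 ->
    exists2 u, C u & forall i, vasympt f u ord0 i < vasympt f v ord0 i.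
  move=> Cv v0; apply: contrapT => nou; move/eqP: v0; apply.
  suff : [set 0] v by [].
  by rewrite -sol0; apply/sol_wP; split=> // u Cu lt; apply: nou; exists u.
have some_pos v : C v -> v != 0 -> exists i, 0 < vasympt f v ord0 i.
  move=> Cv /(dominated _ Cv)[u Cu uv]; apply: contrapT => nopos.
  apply: (no_neg u Cu) => i; rewrite vasympt0; apply: lt_le_trans (uv i) _.
  by rewrite leNgt; apply/negP => vi; apply: nopos; exists i.
(* Twice the sum of the positive parts: a continuous function that is positive where some component
   is. *)
pose phi w := \sum_i (vasympt f w ord0 i + `|vasympt f w ord0 i|).
have pos_part0 w i : 0 <= vasympt f w ord0 i + `|vasympt f w ord0 i|.
  by rewrite -lerBlDl sub0r -normrN ler_norm.
have pos_partc i : continuous (fun w => vasympt f w ord0 i + `|vasympt f w ord0 i|).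
  move=> w; have wc := @continuous_vasympt i w.
  exact: (cvgD wc (cvg_norm wc)).
have phic : continuous phi.
  apply: continuous_big => [|i _]; first exact: add_continuous.
  exact: pos_partc.
have phi0 w : asymptotic_cone C w -> `|w| = 1 -> 0 < phi w.
  move=> /asymptotic_cone_idem Cw w1.
  have [|i wi] := some_pos w Cw; first by rewrite -normr_gt0 w1.
  rewrite /phi (bigD1 i)//= ltr_wpDr ?sumr_ge0//.
  by rewrite addr_gt0// normr_gt0 gt_eqF.
have [e [e0 phi_e]] : exists e, 0 < e /\
    forall x, C x -> e^-1 <= `|x| -> e <= phi (`|x|^-1 *: x).
  have [e] := filter_ex (filterI (nbhs_right_gt (0 : R)) (normalized_lb phic phi0)).
  by move=> [e0 He]; exists e.
(* The degrees [d i] may differ, so only an inequality holds; it uses [t <= t ^+ d i]. *)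
have phiZ t w : 1 <= t -> t * phi w <= phi (t *: w).
  move=> t1; rewrite /phi big_distrr/=; apply: ler_sum => i _.
  have t0 : 0 <= t := le_trans ler01 t1.
  rewrite (vasymptZ t w i) normrM (ger0_norm (exprn_ge0 _ t0)) -mulrDr.
  by rewrite ler_wpM2r// ler_eXnr.
have phi_lb x : C x -> 1 <= `|x| -> e^-1 <= `|x| -> e * `|x| <= phi x.
  move=> Cx x1 xe; have x0 : 0 < `|x| := lt_le_trans ltr01 x1.
  rewrite mulrC; apply: (@le_trans _ _ (`|x| * phi (`|x|^-1 *: x))).
    by rewrite ler_pM2l// phi_e.
  apply: le_trans (phiZ _ _ x1) _.
  by rewrite scalerA divff ?scale1r// gt_eqF.
have bounded_below v : bounded_set (sublevel C (vasympt f) v).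
  (* [S] bounds [phi] on the sublevel set, whereas [phi x >= e * |x|] far away in the cone. *)
  pose S := \sum_i `|vasympt f v ord0 i| *+ 2.
  have S0 : 0 <= S by apply: sumr_ge0 => i _; rewrite mulrn_wge0.
  apply: (@bounded_set_lt _ _ _ (1 + e^-1 + S / e + 1)) => x [Cx xv].
  have e1 : 0 <= e^-1 by rewrite invr_ge0 ltW.
  have Se : 0 <= S / e by rewrite divr_ge0// ltW.
  rewrite ltNge; apply/negP => xlarge.
  have x1 : 1 <= `|x| by apply: le_trans xlarge; lra.
  have xe : e^-1 <= `|x| by apply: le_trans xlarge; lra.
  have Sx : S < e * `|x| by rewrite mulrC -ltr_pdivrMr//; lra.
  have := lt_le_trans Sx (phi_lb x Cx x1 xe); rewrite ltNge => /negP; apply.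
  apply: ler_sum => i _; have := xv i; rewrite mulr2n.
  have := ler_norm (vasympt f v ord0 i); have := normr_ge0 (vasympt f v ord0 i).
  by case: (ger0P (vasympt f x ord0 i)) => ?; lra.
have ge0 v : C v -> forall i, 0 <= vasympt f v ord0 i.
  move=> Cv i.
  have [u us uv] := exists_efficient_below (@closed_asymptotic_cone _ _ K) Cv
    continuous_vasympt (bounded_below v).
  have : sol_w C (vasympt f) u by exact: sol_s_sub_sol_w.
  by rewrite sol0 => /= u0; have := uv i; rewrite u0 vasympt0.
move=> v Cv v0 i; have [u Cu uv] := dominated v Cv v0.
exact: le_lt_trans (ge0 u Cu i) (uv i).
Qed.

Lemma coercive_perturbation :
  (forall v, asymptotic_cone K v -> v != 0 -> forall i, 0 < vasympt f v ord0 i) ->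
  exists2 eps : R, 0 < eps &
    forall g : 'I_s -> mpoly n R, in_Pd d g -> vpnorm g < eps ->
      forall A, exists T, forall x, K x -> T <= `|x| ->
        forall i, A < vpeval (vpadd f g) x ord0 i.
Proof.
move=> pos.
have [c [c0 lb]] : exists c : R, 0 < c /\ forall i x, K x -> c^-1 <= `|x| ->
    c <= vasympt f (`|x|^-1 *: x) ord0 i.
  have lb : \forall c \near (0 : R)^'+, forall i x, K x -> c^-1 <= `|x| ->
      c <= vasympt f (`|x|^-1 *: x) ord0 i.
    apply: filter_forall => i.
    apply: (normalized_lb (phi := fun w => vasympt f w ord0 i)).
      exact: continuous_vasympt.
    by move=> v Kv v1; apply: pos => //; rewrite -normr_gt0 v1.
  have [c] := filter_ex (filterI (nbhs_right_gt (0 : R)) lb).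
  by move=> [c0 H]; exists c.
have [M [N [M0 N0 bound]]] := perturbation_bound f_deg d_ge1.
(* With this bound the perturbation consumes at most half of the linear growth [c * |x|] coming from
   [f]. *)
exists (c / (2 * (N + 1))); first by rewrite divr_gt0// mulr_gt0// ltr_wpDl.
move=> g gd geps A.
have Nc : N * vpnorm g <= c / 2.
  have : (N + 1) * vpnorm g <= c / 2.
    rewrite mulrC -ler_pdivlMr ?ltr_wpDl//.
    by rewrite -mulrA -invfM ltW.
  by apply: le_trans; rewrite ler_wpM2r ?sqrtr_ge0// lerDl.
have MA0 : 0 <= (M + `|A| + 1) / (c / 2).
  by rewrite divr_ge0// ?divr_ge0 ?(ltW c0)// !addr_ge0.
have c10 : 0 <= c^-1 by rewrite invr_ge0 ltW.
exists (1 + c^-1 + (M + `|A| + 1) / (c / 2)) => x Kx Tx i.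
have t1 : 1 <= `|x| by apply: le_trans Tx; lra.
have t0 : 0 < `|x| := lt_le_trans ltr01 t1.
have tA : M + `|A| + 1 <= `|x| * (c / 2).
  by rewrite -ler_pdivrMr ?divr_gt0//; apply: le_trans Tx; lra.
have xc : c^-1 <= `|x| by apply: le_trans Tx; lra.
have wc := lb i x Kx xc.
have xE : x = `|x| *: (`|x|^-1 *: x) by rewrite scalerA divff ?scale1r// gt_eqF.
have w1 : `|(`|x|^-1 *: x)| <= 1 by rewrite normrZ normfV normr_id mulVf// gt_eqF.
have := bound g i _ _ 1 gd t1 (lexx _) w1; rewrite -xE expr1n mul1r.
have -> : `|x| ^+ d i = `|x| * `|x| ^+ (d i).-1 by rewrite -exprS prednK.
have P1 : 1 <= `|x| ^+ (d i).-1 by rewrite exprn_ege1.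
move: (`|x| ^+ _) P1 => P P1 /ler_normlP[+ _].
move: (vpeval _ _ _ _) (vasympt _ _ _ _) wc => y z wc.
rewrite opprB lerBlDr -lerBlDl => ylb; apply: lt_le_trans ylb.
have S1 : `|x| * c <= `|x| * z by rewrite ler_pM2l.
have S2 : N * vpnorm g * `|x| <= c / 2 * `|x| by rewrite ler_pM2r.
rewrite [ltRHS](_ : _ = P * (`|x| * z - (M + N * vpnorm g * `|x|))); last by ring.
apply: (@lt_le_trans _ _ (P * (`|A| + 1))).
  have := ler_norm A; have := normr_ge0 A; nra.
by rewrite ler_pM2l ?(lt_le_trans ltr01)//; lra.
Qed.

Lemma stability_nonempty_compact :
  sol_w (asymptotic_cone K) (vasympt f) = [set 0] ->
  exists2 eps : R, 0 < eps &
    forall g : 'I_s -> mpoly n R, in_Pd d g -> vpnorm g < eps ->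
      sol_s K (vpeval (vpadd f g)) !=set0 /\
      compact (sol_w K (vpeval (vpadd f g))).
Proof.
move=> sol0; have [eps eps0 coercive] := coercive_perturbation (vasympt_gt0 sol0).
exists eps => // g gd geps; have [x0 Kx0] := K_nonempty.
have hc := @continuous_vpeval (vpadd f g); set h := vpeval (vpadd f g) in hc *.
(* The sum dominates every component at [x0], so points of [K] of norm at least [T] are strictly
   dominated by [x0]. This bounds both the weakly efficient set and the sublevel set of [x0]. *)
have [T HT] := coercive g gd geps (\sum_i `|h x0 ord0 i|).
have {}HT x : K x -> T <= `|x| -> forall i, h x0 ord0 i < h x ord0 i.
  move=> Kx Tx i; apply: le_lt_trans (HT x Kx Tx i).
  by rewrite (bigD1 i)//= (le_trans (ler_norm _))// lerDl sumr_ge0.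
have s0 : (0 < s)%N.
  by apply: (@sol_w_gt0 _ _ _ (asymptotic_cone K) (vasympt f) 0); rewrite sol0.
split; last first.
  apply: bounded_closed_compact; last exact: closed_sol_w.
  apply: (@bounded_set_lt _ _ _ T) => x /sol_wP[Kx H].
  by rewrite ltNge; apply/negP => Tx; apply: (H x0 Kx0); exact: HT.
have [|u us _] := exists_efficient_below K_closed Kx0 hc; last by exists u.
apply: (@bounded_set_lt _ _ _ T) => x [Kx H]; rewrite ltNge; apply/negP => Tx.
have := lt_le_trans (HT x Kx Tx (Ordinal s0)) (H (Ordinal s0)).
by rewrite ltxx.
Qed.

End Stability.

Theorem theorem6p1 (R : realType) (n s : nat) (K : set 'rV[R]_n)
    (f : 'I_s -> mpoly n R) (d : 'I_s -> nat)
    (K_nonempty : K !=set0) (K_closed : closed K)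
    (f_deg : forall i, pdeg (f i) = d i) (d_ge1 : forall i, (1 <= d i)%N) :
  (sol_w (asymptotic_cone K) (vasympt f) = set0 ->
   exists2 eps : R, 0 < eps &
     forall g : 'I_s -> mpoly n R, in_Pd d g -> vpnorm g < eps ->
       sol_w K (vpeval (vpadd f g)) = set0)
  /\
  (sol_w (asymptotic_cone K) (vasympt f) = [set 0] ->
   exists2 eps : R, 0 < eps &
     forall g : 'I_s -> mpoly n R, in_Pd d g -> vpnorm g < eps ->
       sol_s K (vpeval (vpadd f g)) !=set0 /\
       compact (sol_w K (vpeval (vpadd f g)))).
Proof.
by split; [exact: stability_empty|exact: stability_nonempty_compact].
Qed.
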